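(* Let $U\subset\mathcal{H}$ be an open set, and let a function $f\colon U\to\mathbb{R}$ be codifferentiable on a convex set $C\subseteq U$. Suppose also that $$R=\sup_{x\in C}\sup\big\{\|v\|\ \big|\ (0,v)\in\underline{d}f(x)+\overline{d}f(x)\big\}<+\infty.$$ Then $f$ is Lipschitz continuous on $C$ with a Lipschitz constant $L=R$. In particular, if $f$ is continuously codifferentiable on $U$, then $f$ is locally Lipschitz continuous on $U$.
   Context: $\mathcal{H}$ is a real Hilbert space with inner product $\langle\cdot,\cdot\rangle$. A function $f$ defined in a neighbourhood of $x$ is codifferentiable at $x$ if there exist (nonempty) weakly compact convex sets $\underline{d}f(x),\overline{d}f(x)\subset\mathbb{R}\times\mathcal{H}$ such that for any $\Delta x\in\mathcal{H}$ $$\lim_{\alpha\to+0}\frac1\alpha\Big|f(x+\alpha\Delta x)-f(x)-\max_{(a,v)\in\underline{d}f(x)}(a+\alpha\langle v,\Delta x\rangle)-\min_{(b,w)\in\overline{d}f(x)}(b+\alpha\langle w,\Delta x\rangle)\Big|=0$$ and $\max_{(a,v)\in\underline{d}f(x)}a+\min_{(b,w)\in\overline{d}f(x)}b=0$. The pair $Df(x)=[\underline{d}f(x),\overline{d}f(x)]$ is called a codifferential of $f$ at $x$. Throughout, codifferentials are normalized: $\max_{(a,v)\in\underline{d}f(x)}a=\min_{(b,w)\in\overline{d}f(x)}b=0$. The result holds for any codifferential mapping $x\mapsto Df(x)$ on $C$ satisfying the assumptions. A function is continuously codifferentiable on $U$ if it is codifferentiable at every point of $U$ and there is a codifferential mapping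 $Df(\cdot)$ such that $\underline{d}f(\cdot)$, $\overline{d}f(\cdot)$ are Hausdorff continuous on $U$. *)

(* Defs.v *)
From HB Require Import structures.
From mathcomp Require Export all_boot all_order all_algebra sesquilinear.
From mathcomp Require Export all_classical all_reals all_analysis.
Export Order.TTheory GRing.Theory Num.Theory.
Export numFieldNormedType.Exports.

#[export] Set Implicit Arguments.
#[export] Unset Strict Implicit.
#[export] Unset Printing Implicit Defensive.

#[global] Open Scope classical_set_scope.
#[global] Open Scope ring_scope.

Definition dual (R : realType) (E : normedModType R) : set (E -> R) :=
  [set phi | linear phi /\ continuous phi].
Arguments dual {R} E _.

(* The weak topology is the initial topology of [z |-> (phi |-> phi z)] for
   pointwise convergence on the dual. *)
Definition dual_eval (R : realType) (E : normedModType R) (z : E) :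
  prod_topology (fun _ : dual E => R) := fun phi => val phi z.

Definition weakly_compact (R : realType) (E : normedModType R) (A : set E) :=
  compact (A : set (initial_topology (@dual_eval R E))).

Definition hausdorff_dist (R : realType) (E : normedModType R)
    (A B : set E) : \bar R :=
  maxe (ereal_sup [set ereal_inf [set `|a - b|%:E | b in B] | a in A])
       (ereal_sup [set ereal_inf [set `|a - b|%:E | a in A] | b in B]).

Definition hausdorff_continuous (R : realType) (H E : normedModType R)
    (U : set H) (F : H -> set E) :=
  forall x, U x ->
    hausdorff_dist (F y) (F x) @[y --> within U (nbhs x)] --> 0%E.

Definition locally_lipschitz (R : realType) (H : normedModType R)
    (U : set H) (f : H -> R) :=
  forall x, U x -> exists2 N : set H, nbhs x N & [lipschitz f y | y in N].

Definition minkowski_sum (R : realType) (E : normedModType R) (A B : set E) :=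
  [set p + q | p in A & q in B].

(* A Hilbert space is a complete normed space [H] with a symmetric positive
   definite bilinear form [ip]; the equation [ip x x = `|x| ^+ 2] linking [ip]
   to the norm is assumed where it is used.  [R * H] carries the max norm of
   the product, which is equivalent to [sqrt (a ^+ 2 + `|v| ^+ 2)]: the dual,
   the weak topology and Hausdorff continuity are the same for both. *)
Section Codifferential.
Context (R : realType) (H : completeNormedModType R) (ip : {dot H for idfun}).
Implicit Types (f : H -> R) (x d : H) (A B : set (R * H)).

(* Extrema over weakly compact sets are attained, so [sup] and [inf] below are
   the maximum and the minimum. *)
Definition max_aff A (alpha : R) d : R :=
  sup [set z.1 + alpha * ip z.2 d | z in A].

Definition min_aff B (alpha : R) d : R :=
  inf [set z.1 + alpha * ip z.2 d | z in B].

Definition max_fst A : R := sup [set z.1 | z in A].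

Definition min_fst B : R := inf [set z.1 | z in B].

(* [f] is total, but [is_codifferential f x A B] only depends on its values in
   a neighbourhood of [x]. *)
Definition is_codifferential f x A B :=
  [/\ [/\ A !=set0, convex_set A & weakly_compact A],
      [/\ B !=set0, convex_set B & weakly_compact B],
      forall d : H,
        alpha^-1 * `|f (x + alpha *: d) - f x
                     - max_aff A alpha d - min_aff B alpha d|
          @[alpha --> 0^'+] --> (0 : R)
    & max_fst A + min_fst B = 0].

Definition is_normalized A B := max_fst A = 0 /\ min_fst B = 0.

Definition codifferential_mapping f (C : set H)
    (lo up : H -> set (R * H)) :=
  forall x, C x ->
    is_codifferential f x (lo x) (up x) /\ is_normalized (lo x) (up x).

Definition continuously_codifferentiable f (U : set H) :=
  exists lo up : H -> set (R * H),
    [/\ codifferential_mapping f U lo up,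
        hausdorff_continuous U lo & hausdorff_continuous U up].

Definition codifferential_bound (C : set H)
    (lo up : H -> set (R * H)) : \bar R :=
  ereal_sup
    [set ereal_sup [set `|v|%:E | v in
                      [set v | minkowski_sum (lo x) (up x) (0, v)]] | x in C].

End Codifferential.

(* Main.v *)
Require Import Defs.
From mathcomp Require Import ring lra.

(** Let [x] be a point of [C] and [d] a direction.  Dividing the expansion of
    [f] at [x] by [alpha] and letting [alpha] decrease to [0], only the pairs of
    the form [(0, v)] survive in the two sets of the codifferential: the
    functions [(a, v) |-> a] and [(a, v) |-> ip v d] are weakly continuous, so
    on the weakly compact set [lo x], where [a <= 0], the pairs that would give
    a slope larger than the one on the face [a = 0] have [a] bounded away from
    [0], and they lose against [0] for small [alpha] ([sup_affine_le]).  Hence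

      [f'(x, d) = max_(0, v) ip v d + min_(0, w) ip w d],

    which by Cauchy-Schwarz is at most [r * `|d|] in absolute value when [r]
    bounds the [`|v + w|].  This enters as an eventual bound on the increments
    of [f] along the ray ([codifferential_increment]), for which it is enough to
    compare the maximum with one fixed [w] and the minimum with one fixed [v].

    On a segment of [C] this bounds all the Dini derivatives of [f], on both
    sides, by the length of the segment times [r], and a mean value argument
    that is a supremum argument turns this into a bound of the increment
    ([dini_bound_increment], [codifferential_lipschitz]).

    For the local statement, a weakly compact set is norm bounded by the uniform
    boundedness principle ([weakly_compact_bounded]), and Hausdorff continuity
    carries a bound at [x] over to a neighbourhood of [x], which can be taken
    convex; the first part applies there. *)

(** * Affine functions with small slopes on a compact set *)

(** On the part of [K] where [p] is at least [m + e], which is compact and avoids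
    the face [a = 0], the maximum of [a] is negative, and [t * p] is too small
    to compensate for it.  Elsewhere the bound holds term by term. *)
Lemma compact_affine_le (R : realType) (T : topologicalType) (K : set T)
    (a p : T -> R) (m e : R) :
  compact K -> continuous a -> continuous p ->
  (forall z, K z -> a z <= 0) -> (forall z, K z -> a z = 0 -> p z <= m) ->
  0 < e ->
  \forall t \near 0^'+, forall z, K z -> a z + t * p z <= t * (m + e).
Proof.
move=> cK ca cp a_le0 p_le e0.
have small_slope z : K z -> p z <= m + e -> forall t, 0 < t ->
    a z + t * p z <= t * (m + e).
  move=> Kz pz t t0; rewrite -[leRHS]add0r lerD ?a_le0 //.
  by rewrite ler_wpM2l // ltW.
pose K' := K `&` p @^-1` [set x | m + e <= x].
have cK' : compact K'.
  apply: compact_closedI => //; apply: closed_comp; last exact: closed_ge.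
  by move=> z _; exact: cp.
have [[z0 K'z0]|K'0] := pselect (K' !=set0); last first.
  near=> t => z Kz; apply: small_slope => //.
  by have [//|/ltW pz] := leP (p z) (m + e); case: K'0; exists z.
have [c /set_mem[Kc /= pc] cmax] : exists2 c, c \in K' &
    forall z, z \in K' -> a z <= a c.
  apply: compact_EVT_max => //; first by exists z0.
  by apply: continuous_subspaceT; exact: ca.
have [d _ dmax] : exists2 c, c \in K' & forall z, z \in K' -> p z <= p c.
  apply: compact_EVT_max => //; first by exists z0.
  by apply: continuous_subspaceT; exact: cp.
have ac : a c < 0.
  rewrite lt_neqAle a_le0 // andbT; apply/eqP => ac0.
  have pm := p_le _ Kc ac0; lra.
have pd : m + e <= p d.
  by rewrite (le_trans pc) // dmax //; apply/mem_set.
have P0 : 0 < p d - (m + e) + 1 by lra.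
near=> t => z Kz.
have t0 : 0 < t by [].
have [pz|/ltW pz] := leP (p z) (m + e); first exact: small_slope.
have zK' : z \in K' by apply/mem_set.
have ac_ge := cmax _ zK'; have pzd := dmax _ zK'.
have : t * (p d - (m + e) + 1) <= - a c.
  rewrite -ler_pdivlMr //; near: t; apply: nbhs_right_ltW.
  by rewrite divr_gt0 // oppr_gt0.
have : t * p z <= t * p d by rewrite ler_wpM2l // ltW.
lra.
Unshelve. all: by end_near. Qed.

Section SupAffine.
Context (R : realType) (T : topologicalType) (K : set T) (a p : T -> R).
Hypotheses (cK : compact K) (K0 : K !=set0).
Hypotheses (ca : continuous a) (cp : continuous p).

Let continuous_affine (t : R) : continuous (fun z => a z + t * p z).
Proof. by move=> z; apply: cvgD; [exact: ca|apply: cvgMr; exact: cp]. Qed.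

Lemma sup_affine_ge (z : T) (t : R) : K z -> a z = 0 ->
  t * p z <= sup [set a y + t * p y | y in K].
Proof.
move=> Kz az0; apply: sup_upper_bound; last by exists z; rewrite ?az0 ?add0r.
apply: compact_has_sup; first by exists (a z + t * p z), z.
apply: continuous_compact => //; apply: continuous_subspaceT.
exact: continuous_affine.
Qed.

Lemma sup_eq0_attained : sup [set a z | z in K] = 0 -> exists2 z, K z & a z = 0.
Proof.
move=> supa.
have [|c /set_mem Kc cmax] := compact_EVT_max (f := a) K0 cK.
  by apply: continuous_subspaceT.
exists c => //; rewrite -supa; apply/le_anti/andP; split.
  apply: sup_upper_bound; last by exists c.
  by split; [exists (a c), c|exists (a c) => _ [z Kz <-]; rewrite cmax ?inE].
apply: ge_sup; first by exists (a c), c.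
by move=> _ [z Kz <-]; rewrite cmax ?inE.
Qed.

Lemma sup_affine_le (m e : R) : sup [set a z | z in K] = 0 ->
  (forall z, K z -> a z = 0 -> p z <= m) -> 0 < e ->
  \forall t \near 0^'+, sup [set a z + t * p z | z in K] <= t * (m + e).
Proof.
move=> supa p_le e0.
have a_le0 z : K z -> a z <= 0.
  move=> Kz; rewrite -supa; apply: sup_upper_bound; last by exists z.
  apply: compact_has_sup; first by exists (a z), z.
  by apply: continuous_compact => //; exact: continuous_subspaceT.
have := compact_affine_le cK ca cp a_le0 p_le e0.
apply: filterS => t le_t; apply: ge_sup.
  by case: K0 => z Kz; exists (a z + t * p z), z.
by move=> _ [z Kz <-]; exact: le_t.
Qed.

End SupAffine.

(** Turns the minimum over the second set of a codifferential into a maximum,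
    so that one analysis of suprema serves both sets. *)
Lemma inf_imageE (R : realType) (T : Type) (B : set T) (g : T -> R) :
  inf [set g z | z in B] = - sup [set - g z | z in B].
Proof. by rewrite /inf image_comp. Qed.

(** * A mean value inequality *)

(** The points [t] with [`|g t - g 0| <= c * t] contain their supremum [s], by
    the bound on the left of [s]; the bound on its right would give larger ones
    if [s < 1].  Continuity of [g] is contained in the hypothesis. *)
Lemma dini_bound_increment (R : realType) (g : R -> R) (c : R) :
  (forall s, 0 <= s <= 1 -> \forall h \near 0^'+,
     `|g (s + h) - g s| <= c * h /\ `|g (s - h) - g s| <= c * h) ->
  `|g 1 - g 0| <= c.
Proof.
move=> loc.
pose S := [set t : R | 0 <= t <= 1 /\ `|g t - g 0| <= c * t].
have S0 : S 0 by split; rewrite ?lexx ?ler01 // subrr normr0 mulr0.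
have supS : has_sup S by split; [exists 0 | exists 1 => t [/andP[]]].
set s := sup S.
have s_ge0 : 0 <= s by exact: sup_upper_bound.
have s_le1 : s <= 1 by apply: ge_sup; [exists 0|move=> t [/andP[]]].
have s01 : 0 <= s <= 1 by rewrite s_ge0 s_le1.
have [d /= d0 dP] := loc _ s01.
have {}dP h : 0 < h -> h < d ->
    `|g (s + h) - g s| <= c * h /\ `|g (s - h) - g s| <= c * h.
  by move=> h0 hd; apply: dP => //=; rewrite sub0r normrN gtr0_norm.
have Ss : `|g s - g 0| <= c * s.
  have [t [t01 St] st] := sup_adherent d0 supS.
  have : t <= s by apply: sup_upper_bound.
  rewrite le_eqVlt => /orP[/eqP <- //|ts].
  have [||_] := dP (s - t); rewrite ?subr_gt0 //; first by rewrite -/s in st; lra.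
  rewrite subKr => gts.
  rewrite (_ : g s - g 0 = (g t - g 0) - (g t - g s)); last by ring.
  by rewrite (le_trans (ler_normB _ _)) //; lra.
have [s1|s1] := ltP s 1; last first.
  have s_eq1 : s = 1 by apply/le_anti; rewrite s_le1.
  by move: Ss; rewrite s_eq1 mulr1.
pose h := Num.min (d / 2) (1 - s).
have h0 : 0 < h by rewrite lt_min; apply/andP; split; lra.
have hd : h < d by rewrite gt_min; apply/orP; left; lra.
have hs : h <= 1 - s by rewrite ge_min lexx orbT.
have [gh _] := dP h h0 hd.
have : s + h <= s; last by lra.
apply: sup_upper_bound => //; split; first by apply/andP; split; lra.
rewrite (_ : g (s + h) - g 0 = (g (s + h) - g s) + (g s - g 0)); last by ring.
by rewrite (le_trans (ler_normD _ _)) //; lra.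
Qed.

(** * Weakly continuous functionals *)

Lemma cauchy_schwarz (R : realType) (H : completeNormedModType R)
    (ip : {dot H for idfun}) (ip_norm : forall x : H, ip x x = `|x| ^+ 2)
    (u v : H) :
  `|ip u v| <= `|u| * `|v|.
Proof.
have ipC x y : ip x y = ip y x by rewrite hermC expr0 mul1r.
suff le w : ip w v <= `|w| * `|v|.
  rewrite ler_norml le andbT lerNl -linearNl.
  by rewrite (le_trans (le _)) // normrN.
have [->|w0] := eqVneq w 0; first by rewrite linear0l normr0 mul0r.
have [->|v0] := eqVneq v 0; first by rewrite linear0r normr0 mulr0.
have wv0 : 0 < `|w| * `|v| by rewrite mulr_gt0 ?normr_gt0.
have : 0 <= `| `|v| *: w - `|w| *: v | ^+ 2 by rewrite exprn_ge0.
rewrite -ip_norm linearBl !linearBr !linearZl_LR !linearZr_LR /= !ip_norm.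
rewrite (ipC v w) /GRing.scale /= => sq_ge0.
have : 0 <= (`|w| * `|v|) * (`|w| * `|v| - ip w v) by lra.
by rewrite pmulr_rge0 // subr_ge0.
Qed.

Lemma weakly_continuous_dual (R : realType) (E : normedModType R)
    (phi : E -> R) :
  dual E phi ->
  continuous (phi : initial_topology (@dual_eval R E) -> R).
Proof.
move=> phiD.
pose i : dual E := exist _ phi (mem_set phiD).
have phiE : phi = proj i \o @dual_eval R E by [].
move=> z; rewrite phiE; apply: continuous_comp.
  exact: initial_continuous.
exact: (@proj_continuous (dual E) (fun=> R)).
Qed.

Lemma dual_opp (R : realType) (E : normedModType R) (phi : E -> R) :
  dual E phi -> dual E (fun z => - phi z).
Proof.
move=> [phi_lin phi_cont]; split; last by move=> z; apply: cvgN; exact: phi_cont.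
by move=> k x y; rewrite phi_lin opprD scalerN.
Qed.

Lemma dual_fst (R : realType) (H : normedModType R) :
  dual (R * H)%type (@fst R H : R * H -> R).
Proof. by split; [move=> k x y | move=> z; exact: cvg_fst]. Qed.

(** * Increments of a codifferentiable function *)

Section Codifferential.
Context (R : realType) (H : completeNormedModType R) (ip : {dot H for idfun}).
Hypothesis ip_norm : forall x : H, ip x x = `|x| ^+ 2.

Lemma continuous_ipl (d : H) : continuous (fun v : H => ip v d).
Proof.
move=> v; apply/cvgrPdist_le => e e0.
have d0 : 0 < `|d| + 1 by rewrite ltr_wpDl.
near=> w.
rewrite -linearBl (le_trans (cauchy_schwarz ip_norm _ _)) //.
rewrite (@le_trans _ _ (`|v - w| * (`|d| + 1))) ?ler_wpM2l ?lerDl //.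
rewrite -ler_pdivlMr //; near: w; apply: cvgr_dist_le => //.
by rewrite divr_gt0.
Unshelve. all: by end_near. Qed.

Lemma dual_ip_snd (d : H) : dual (R * H)%type (fun z => ip z.2 d).
Proof.
split; first by move=> k x y; rewrite /= linearDl linearZl_LR.
move=> z; apply: (@continuous_comp _ _ _ snd (ip ^~ d)); first exact: cvg_snd.
exact: continuous_ipl.
Qed.

Lemma min_fst_eq0 (B : set (R * H)) :
  min_fst B = 0 -> sup [set - z.1 | z in B] = 0.
Proof. by rewrite /min_fst inf_imageE => /eqP; rewrite oppr_eq0 => /eqP. Qed.

Lemma normalized_face_nonempty (A B : set (R * H)) :
  A !=set0 -> B !=set0 -> weakly_compact A -> weakly_compact B ->
  is_normalized A B ->
  (exists v, A (0, v)) /\ (exists w, B (0, w)).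
Proof.
move=> A0 B0 cA cB [supA infB].
have fst_cont := weakly_continuous_dual (dual_fst H).
have [[a v] /= Av av0] := sup_eq0_attained cA A0 fst_cont supA.
have fstN_cont := weakly_continuous_dual (dual_opp (dual_fst H)).
have infB' := min_fst_eq0 infB.
have [[b w] /= Bw /eqP] := sup_eq0_attained cB B0 fstN_cont infB'.
rewrite oppr_eq0 => /eqP bw0.
by split; [exists v; rewrite -av0|exists w; rewrite -bw0].
Qed.

(** Fix [(0, v0)] in [A] and [(0, w0)] in [B].  By Cauchy-Schwarz the slopes
    [ip v d] on the face of [A] are at most [r * `|d| - ip w0 d], so to first
    order [max_aff] is at most [t] times this, while [min_aff] is at most
    [t * ip w0 d]: in the sum [w0] cancels.  The lower bound is the same
    argument with [v0]. *)
Lemma codifferential_increment (f : H -> R) (x d : H) (A B : set (R * H))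
    (r e : R) :
  is_codifferential ip f x A B -> is_normalized A B ->
  (forall v, minkowski_sum A B (0, v) -> `|v| <= r) -> 0 < e ->
  \forall t \near 0^'+, `|f (x + t *: d) - f x| <= (r * `|d| + e) * t.
Proof.
move=> [[A0 _ cA] [B0 _ cB] fAB _] nAB rP e0.
have [[v0 Av0] [w0 Bw0]] := normalized_face_nonempty A0 B0 cA cB nAB.
have [supA infB] := nAB.
have sum_le v w : A (0, v) -> B (0, w) -> `|ip v d + ip w d| <= r * `|d|.
  move=> Av Bw; rewrite -linearDl (le_trans (cauchy_schwarz ip_norm _ _)) //.
  rewrite ler_wpM2r // rP //; exists (0, v) => //; exists (0, w) => //.
  by congr (_, _); rewrite /= addr0.
have fst_cont := weakly_continuous_dual (dual_fst H).
have ip_cont := weakly_continuous_dual (dual_ip_snd d).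
have fstN_cont := weakly_continuous_dual (dual_opp (dual_fst H)).
have ipN_cont := weakly_continuous_dual (dual_opp (dual_ip_snd d)).
have infB' := min_fst_eq0 infB.
have min_affE t :
    min_aff ip B t d = - sup [set - z.1 + t * - ip z.2 d | z in B].
  rewrite /min_aff inf_imageE; congr (- sup _).
  by apply: eq_imagel => z _; rewrite opprD mulrN.
(* One half of [e] pays for the error of the expansion, the other one for the
   first order bound of [sup_affine_le]. *)
have e2 : 0 < e / 2 by lra.
near=> t.
have t0 : 0 < t by [].
have max_ge : t * ip v0 d <= max_aff ip A t d.
  exact: (sup_affine_ge cA fst_cont ip_cont t Av0).
have min_le : t * - ip w0 d <= - min_aff ip B t d.
  rewrite min_affE opprK.
  by apply: (sup_affine_ge cB fstN_cont ipN_cont t Bw0); rewrite /= oppr0.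
have max_le : max_aff ip A t d <= t * (r * `|d| - ip w0 d + e / 2).
  near: t; apply: (sup_affine_le cA A0 fst_cont ip_cont supA) => //.
  move=> [a v] /= Av a0; rewrite a0 in Av.
  by have /ler_normlP[_] := sum_le _ _ Av Bw0; lra.
have min_ge : - min_aff ip B t d <= t * (r * `|d| + ip v0 d + e / 2).
  rewrite min_affE opprK; near: t.
  apply: (sup_affine_le cB B0 fstN_cont ipN_cont infB') => //.
  move=> [b w] /= Bw /eqP; rewrite oppr_eq0 => /eqP b0; rewrite b0 in Bw.
  by have /ler_normlP[+ _] := sum_le _ _ Av0 Bw; lra.
have : `|f (x + t *: d) - f x - max_aff ip A t d - min_aff ip B t d|
    <= e / 2 * t.
  rewrite -ler_pdivrMr // mulrC -[leLHS]ger0_norm; last first.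
    by rewrite mulr_ge0 // invr_ge0 ltW.
  by near: t; apply: cvgr0_norm_le.
move=> /ler_normlP[lo up]; apply/ler_normlP; split; lra.
Unshelve. all: by end_near. Qed.

End Codifferential.

(** * Lipschitz continuity *)

Section Lipschitz.
Context (R : realType) (H : completeNormedModType R) (ip : {dot H for idfun}).
Hypothesis ip_norm : forall x : H, ip x x = `|x| ^+ 2.

Lemma convex_set_segment (C : set H) (x y : H) (s : R) :
  convex_set C -> C x -> C y -> 0 <= s <= 1 -> C (x + s *: (y - x)).
Proof.
move=> cvxC Cx Cy /andP[s0 s1].
have -> : x + s *: (y - x) = s *: y + (1 - s) *: x.
  by rewrite scalerBl scale1r scalerBr addrCA.
exact: set_mem (cvxC y x (Itv01 s0 s1) (mem_set Cy) (mem_set Cx)).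
Qed.

Lemma codifferential_lipschitz (f : H -> R) (C : set H)
    (lo up : H -> set (R * H)) (r : R) :
  convex_set C -> codifferential_mapping ip f C lo up ->
  (forall x v, C x -> minkowski_sum (lo x) (up x) (0, v) -> `|v| <= r) ->
  r.-lipschitz_C f.
Proof.
move=> cvxC fC rP [y x] /= [Cy Cx].
apply/ler_addgt0Pr => e e0.
pose g s := f (x + s *: (y - x)).
have -> : f y - f x = g 1 - g 0.
  by rewrite /g scale1r scale0r addr0 [x + _]addrC subrK.
(* Both one-sided bounds come from the expansion at the same point of the
   segment, in the directions [y - x] and [- (y - x)]. *)
apply: dini_bound_increment => s s01.
have Cz := convex_set_segment cvxC Cx Cy s01.
have [fz nz] := fC _ Cz.
have incr d := codifferential_increment ip_norm d fz nz
  (fun v => @rP _ v Cz) e0.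
have := incr (y - x); have := incr (- (y - x)); rewrite normrN.
apply: filterS2 => h lt_ gt_; split.
  by rewrite /g scalerDl addrA.
by rewrite /g scalerBl addrA -scalerN.
Qed.

Lemma codifferential_bound_ub (C : set H) (lo up : H -> set (R * H)) (x v : H) :
  C x -> minkowski_sum (lo x) (up x) (0, v) ->
  (`|v|%:E <= codifferential_bound C lo up)%E.
Proof.
move=> Cx v_sum; apply: le_trans (ereal_sup_ubound _); last by exists x.
by apply: ereal_sup_ubound; exists v.
Qed.

(** Each functional [ip ^~ d] is weakly continuous, hence bounded on [A], so
    the functionals [ip z.2] for [z] in [A] are pointwise bounded, and by
    Banach-Steinhaus uniformly bounded on the unit ball; evaluating them at
    [z.2 / `|z.2|] gives the norms. *)
Lemma weakly_compact_bounded (A : set (R * H)) :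
  weakly_compact A -> exists M, forall z, A z -> `|z.2| <= M.
Proof.
move=> cA.
have [||M MP] := @Banach_Steinhauss R H R [set (ip z.2 : H -> R) | z in A] _ _ 1.
- move=> _ [z Az <-]; split.
    move=> r; exists (`|z.2| * r) => x xr.
    by rewrite (le_trans (cauchy_schwarz ip_norm _ _)) // ler_wpM2l.
  by move=> k x y; rewrite linearPr.
- move=> d; have /compact_bounded[M [_ MP]] := continuous_compact
    (continuous_subspaceT (weakly_continuous_dual (dual_ip_snd ip_norm d))) cA.
  (* A bounded set is bounded by every number larger than [M]. *)
  exists (M + 1) => _ [z Az <-]; apply: (MP (M + 1)); first by rewrite ltrDl.
  by exists z.
exists M => z Az.
have [->|z0] := eqVneq z.2 0.
  (* The value at [0] of any functional of the family shows [0 <= M]. *)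
  rewrite normr0 -(normr0 R) -(linear0r ip z.2).
  by apply: MP; [exists z|rewrite normr0].
have := MP _ (imageP (fun z => ip z.2 : H -> R) Az) (`|z.2|^-1 *: z.2).
rewrite linearZr_LR /= ip_norm normrZ normfV normr_id mulVf ?normr_eq0 //.
rewrite /GRing.scale /= expr2 mulKf ?normr_eq0 // normr_id.
exact.
Qed.

(** For [y] near [x] every point of [F y] is at distance less than [1] from a
    point of [F x], so a bound for [F x] increased by [1] serves for [F y]. *)
Lemma hausdorff_continuous_bounded (U : set H) (F : H -> set (R * H)) (x : H) :
  open U -> U x -> hausdorff_continuous U F -> weakly_compact (F x) ->
  exists M, \forall y \near x, forall z, F y z -> `|z.2| <= M.
Proof.
move=> oU Ux /(_ x Ux) cF /weakly_compact_bounded[M MP]; exists (M + 1).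
have : \forall y \near x, (hausdorff_dist (F y) (F x) < 1)%E.
  have dist_lt1 : nbhs (0 : \bar R) [set d | (d < 1)%E].
    by apply: open_nbhs_nbhs; split; [exact: open_ereal_lt_ereal|exact: lte01].
  have Ux' : nbhs x U by exact: open_nbhs_nbhs.
  have /= lt1 := cF _ dist_lt1; near=> y.
  have Uy : U y by near: y.
  by move: Uy; near: y; exact: lt1.
apply: filterS => y; rewrite /hausdorff_dist gt_max => /andP[dist_lt1 _] z Fz.
have /ereal_inf_lt[_ [b Fb <-]] : (ereal_inf [set `|z - b|%:E | b in F x] < 1)%E.
  by apply: le_lt_trans dist_lt1; apply: ereal_sup_ubound; exists z.
rewrite lte_fin => zb1.
rewrite -(subrK b.2 z.2) (le_trans (ler_normD _ _)) // addrC lerD ?MP //.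
by rewrite (le_trans _ (ltW zb1)) // prod_normE le_max lexx orbT.
Unshelve. all: by end_near. Qed.

Lemma continuously_codifferentiable_locally_lipschitz (f : H -> R) (U : set H) :
  open U -> continuously_codifferentiable ip f U -> locally_lipschitz U f.
Proof.
move=> oU [lo [up [fU lo_cont up_cont]]] x Ux.
have [[[_ _ clo] [_ _ cup] _ _] _] := fU _ Ux.
have [M1 lo_bnd] := hausdorff_continuous_bounded oU Ux lo_cont clo.
have [M2 up_bnd] := hausdorff_continuous_bounded oU Ux up_cont cup.
have [B B_convex [B_open B_nbhs]] := @locally_convex R H.
have : nbhs x [set y | [/\ U y, forall z, lo y z -> `|z.2| <= M1 &
    forall z, up y z -> `|z.2| <= M2]].
  near=> y; split; near: y => //; exact: open_nbhs_nbhs.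
move=> /B_nbhs[N [BN Nx] NP]; exists N.
  by apply: open_nbhs_nbhs; split => //; exact: B_open.
have N_convex := B_convex _ (mem_set BN).
apply: (@klipschitzW _ _ _ (M1 + M2)).
  exact: (@globally_properfilter _ _ (x, x)).
apply: (codifferential_lipschitz N_convex (lo := lo) (up := up)).
  by move=> y /NP[Uy _ _]; exact: fU.
move=> y v /NP[_ loP upP] [p lo_p [q up_q [_ <-]]].
by rewrite (le_trans (ler_normD _ _)) // lerD ?loP ?upP.
Unshelve. all: by end_near. Qed.

End Lipschitz.

Theorem corollary2 (R : realType) (H : completeNormedModType R)
    (ip : {dot H for idfun}) (ip_norm : forall x : H, ip x x = `|x| ^+ 2)
    (U : set H) (U_open : open U) (f : H -> R) :
  (forall C : set H, convex_set C -> C `<=` U ->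
     forall lo up : H -> set (R * H),
       codifferential_mapping ip f C lo up ->
       (codifferential_bound C lo up < +oo)%E ->
       (fine (codifferential_bound C lo up)).-lipschitz_C f) /\
  (continuously_codifferentiable ip f U -> locally_lipschitz U f).
Proof.
split; last exact: continuously_codifferentiable_locally_lipschitz.
move=> C cvxC _ lo up fC bnd_lty.
apply: (codifferential_lipschitz ip_norm cvxC fC) => x v Cx v_sum.
(* For empty [C] the supremum is [-oo] and [fine] sends it to [0]; a vector [v]
   at hand makes the supremum finite. *)
have v_le := codifferential_bound_ub Cx v_sum.
rewrite -lee_fin fineK // fin_numElt bnd_lty andbT.
by rewrite (lt_le_trans _ v_le) ?ltNyr.
Qed.
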